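(* Let $\mathcal{C}$ be a strongly connected category with pairwise coproducts, let $\mathcal F:\mathcal{C}\to \mathrm{Ab}$ be a functor to the category of abelian groups, and let $c\in\mathcal{C}$ be any object. Then for every $n\ge 0$ there is an isomorphism $$\mathrm{lim}^n\,\mathcal F\;\cong\;\pi^n\,\mathcal F B(c),$$ where $B(c)$ is the standard complex associated with $c$.
   Context: A category $\mathcal{C}$ is strongly connected if $\mathrm{Hom}_{\mathcal C}(c,c')\neq\emptyset$ for all objects $c,c'$. It is a category with pairwise coproducts if the coproduct $c\sqcup c'$ exists for all $c,c'$ (so all finite non-empty coproducts exist; an initial object is not required). The higher limits $\mathrm{lim}^i\,\mathcal F$ are the right derived functors of $\mathrm{lim}:\mathrm{Ab}^{\mathcal C}\to\mathrm{Ab}$ evaluated at $\mathcal F$. Standing assumption: the functor category $\mathrm{Ab}^{\mathcal C}$ has enough injectives (e.g. $\mathcal C$ is small), so that higher limits exist. The standard complex associated with $c$ is the cosimplicial object $B(c):\Delta\to\mathcal C$ with $B(c)^n=\bigsqcup_{j=0}^n c$ and, for $f:[n]\to[m]$ in $\Delta$, $B(c)(f)=(i_{f(0)},\dots,i_{f(n)}):\bigsqcup_{j=0}^n c\to\bigsqcup_{k=0}^m c$. Here $i_j:c\to\bigsqcup_{k=0}^m c$ are the canonical inclusions and $(g_0,\dots,g_n)$ denotes the unique map $c^{\sqcup (n+1)}\to c'$ with $(g_0,\dots,g_n)\circ i_j=g_j$. In particular the cofaces are $d^j=(i_0,\dots,\hat i_j,\dots,i_{n+1})$. For a cosimplicial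 abelian group $A$, the alternate sum complex $CA$ has $CA^n=A^n$ with differential $d=\sum_{i=0}^{n+1}(-1)^i d^i$, and $\pi^n A:=H^n(CA)$. $\mathcal F B(c)$ is the cosimplicial abelian group obtained by composing $B(c)$ with $\mathcal F$. *)

(* Defs.v *)
From HB Require Import structures.
From mathcomp Require Import all_boot all_algebra ring_quotient zify.
From mathcomp Require Import boolp.

Set Implicit Arguments.
Unset Strict Implicit.
Unset Printing Implicit Defensive.

Import GRing.Theory.
Local Open Scope ring_scope.
#[local] Obligation Tactic := idtac.

Record category := Category {
  ob :> Type;
  hom : ob -> ob -> Type;
  idm : forall x, hom x x;
  comp : forall x y z, hom y z -> hom x y -> hom x z;
  compIm : forall x y (f : hom x y), comp (idm y) f = f;
  compmI : forall x y (f : hom x y), comp f (idm x) = f;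
  compA : forall x y z t (h : hom z t) (g : hom y z) (f : hom x y),
    comp h (comp g f) = comp (comp h g) f
}.

Arguments hom {c} x y.
Arguments idm {c} x.
Arguments comp {c x y z} g f.

Record functor (C D : category) := Functor {
  fob :> C -> D;
  fmap : forall x y, hom x y -> hom (fob x) (fob y);
  fmapI : forall x, fmap (idm x) = idm (fob x);
  fmapC : forall x y z (g : hom y z) (f : hom x y),
    fmap (comp g f) = comp (fmap g) (fmap f)
}.

Arguments fmap {C D} f {x y} g : rename.

(** Functors to abelian groups.  They are not an instance of [functor]: a
    [category] whose type of objects is [zmodType] lives in a universe too large
    for the limit of a functor (a group of families indexed by the objects) to be
    a [zmodType] again. *)
Record abfunctor (C : category) := AbFunctor {
  aob :> C -> zmodType;
  amap : forall x y, hom x y -> {additive aob x -> aob y};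
  amapI : forall x (u : aob x), amap (idm x) u = u;
  amapC : forall x y z (g : hom y z) (f : hom x y) (u : aob x),
    amap (comp g f) u = amap g (amap f u)
}.

Arguments amap {C} F {x y} f : rename.

Record nattrans (C : category) (F G : abfunctor C) := NatTrans {
  ntcomp :> forall x, {additive F x -> G x};
  ntnat : forall x y (f : hom x y) (u : F x),
    amap G f (ntcomp x u) = ntcomp y (amap F f u)
}.

Program Definition nt_comp (C : category) (F G H : abfunctor C)
    (t : nattrans G H) (s : nattrans F G) : nattrans F H :=
  {| ntcomp := fun x => t x \o s x |}.
Next Obligation. by move=> C F G H t s x y f u /=; rewrite !ntnat. Qed.

Program Definition compose (C D : category) (F : abfunctor D) (B : functor C D) :
    abfunctor C :=
  {| aob := fun x => F (B x); amap := fun x y f => amap F (fmap B f) |}.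
Next Obligation. by move=> C D F B x u /=; rewrite fmapI amapI. Qed.
Next Obligation. by move=> C D F B x y z g f u /=; rewrite fmapC amapC. Qed.

Record complex := Complex {
  cob :> nat -> zmodType;
  cdiff : forall n, {additive cob n -> cob n.+1};
  cdiffK : forall n (u : cob n), cdiff n.+1 (cdiff n u) = 0
}.

Section Cohomology.
Variables (A : complex) (n : nat).

Definition cocycle_pred : pred (A n) := fun u => cdiff A n u == 0.

Lemma cocycle_closed : zmod_closed cocycle_pred.
Proof.
split=> [|u v]; rewrite !unfold_in /cocycle_pred ?raddf0 // => /eqP u0 /eqP v0.
by rewrite raddfB u0 v0 subrr.
Qed.

HB.instance Definition _ := GRing.isZmodClosed.Build (A n) cocycle_pred
  cocycle_closed.

Record cocycle := Cocycle { cocycle_val : A n; _ : cocycle_val \in cocycle_pred }.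

HB.instance Definition _ := [isSub for cocycle_val].
HB.instance Definition _ := [Choice of cocycle by <:].
HB.instance Definition _ := [SubChoice_isSubZmodule of cocycle by <:].

Definition is_coboundary : A n -> Prop :=
  match n return A n -> Prop with
  | 0 => fun u => u = 0
  | m.+1 => fun u => exists v : A m, cdiff A m v = u
  end.

Definition coboundary : pred cocycle := fun u => `[< is_coboundary (val u) >].

Lemma coboundary_closed : zmod_closed coboundary.
Proof.
suff [h0 hB] : is_coboundary 0 /\
    forall u v, is_coboundary u -> is_coboundary v -> is_coboundary (u - v).
  split=> [|u v]; rewrite !unfold_in; first by apply/asboolP; rewrite raddf0.
  move=> /asboolP hu /asboolP hv; apply/asboolP; rewrite raddfB; exact: hB.
rewrite /is_coboundary; case: (n) => [|m]; split.
- by [].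
- by move=> u v -> ->; rewrite subrr.
- by exists 0; rewrite raddf0.
- by move=> _ _ [u <-] [v <-]; exists (u - v); rewrite raddfB.
Qed.

HB.instance Definition _ := GRing.isZmodClosed.Build cocycle coboundary
  coboundary_closed.

Definition cohomology : zmodType := Quotient.quot (GRing.ZmodClosed.clone _ coboundary _).

End Cohomology.

Section Limit.
Variables (C : category) (F : abfunctor C).

Definition compatible : pred (forall x, F x) :=
  fun s => `[< forall x y (f : hom x y), amap F f (s x) = s y >].

Record lim := Lim { lim_val : forall x, F x; _ : compatible lim_val }.

HB.instance Definition _ := [isSub for lim_val].
HB.instance Definition _ := [Choice of lim by <:].

Lemma limP (s : lim) x y (f : hom x y) : amap F f (lim_val s x) = lim_val s y.
Proof. by case: s => s /= /asboolP; apply. Qed.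

Program Definition lim0 := @Lim (fun x => 0) _.
Next Obligation. by apply/asboolP => x y f; rewrite raddf0. Qed.
Program Definition limN s := @Lim (fun x => - lim_val s x) _.
Next Obligation. by move=> s; apply/asboolP => x y f; rewrite raddfN /= limP. Qed.
Program Definition limD s t := @Lim (fun x => lim_val s x + lim_val t x) _.
Next Obligation. by move=> s t; apply/asboolP => x y f; rewrite raddfD /= !limP. Qed.

Lemma limDA : associative limD.
Proof. by move=> s t u; apply/val_inj/functional_extensionality_dep => x; apply: addrA. Qed.
Lemma limDC : commutative limD.
Proof. by move=> s t; apply/val_inj/functional_extensionality_dep => x; apply: addrC. Qed.
Lemma lim0D : left_id lim0 limD.
Proof. by move=> s; apply/val_inj/functional_extensionality_dep => x; apply: add0r. Qed.
Lemma limND : left_inverse lim0 limN limD.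
Proof. by move=> s; apply/val_inj/functional_extensionality_dep => x; apply: addNr. Qed.

HB.instance Definition _ := GRing.isZmodule.Build lim limDA limDC lim0D limND.

End Limit.

Section LimMap.
Variables (C : category) (F G : abfunctor C) (t : nattrans F G).

Program Definition lim_map (s : lim F) : lim G := @Lim _ _ (fun x => t x (lim_val s x)) _.
Next Obligation. by move=> s; apply/asboolP => x y f; rewrite ntnat limP. Qed.

Lemma lim_map_is_zmod_morphism : zmod_morphism lim_map.
Proof.
by move=> u v; apply/val_inj/functional_extensionality_dep => x; apply: raddfB.
Qed.

HB.instance Definition _ := GRing.isZmodMorphism.Build (lim F) (lim G) lim_map
  lim_map_is_zmod_morphism.

End LimMap.

(** Kernels and cokernels in [Ab^C] are computed objectwise, so monomorphisms and
    exactness are objectwise. *)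
Definition is_mono (C : category) (F G : abfunctor C) (t : nattrans F G) : Prop :=
  forall x, injective (t x).

Definition is_exact (C : category) (F G H : abfunctor C)
    (s : nattrans F G) (t : nattrans G H) : Prop :=
  forall x (u : G x), t x u = 0 <-> exists v : F x, s x v = u.

Definition is_injective (C : category) (I : abfunctor C) : Prop :=
  forall (F G : abfunctor C) (m : nattrans F G) (f : nattrans F I),
    is_mono m -> exists g : nattrans G I, forall x u, g x (m x u) = f x u.

Definition enough_injectives (C : category) : Prop :=
  forall F : abfunctor C,
    exists (I : abfunctor C) (m : nattrans F I), is_injective I /\ is_mono m.

Record injective_resolution (C : category) (F : abfunctor C) := InjectiveResolution {
  res_ob :> nat -> abfunctor C;
  res_aug : nattrans F (res_ob 0);
  res_diff : forall n, nattrans (res_ob n) (res_ob n.+1);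
  res_inj : forall n, is_injective (res_ob n);
  res_mono : is_mono res_aug;
  res_exact0 : is_exact res_aug (res_diff 0);
  res_exactS : forall n, is_exact (res_diff n) (res_diff n.+1)
}.

Section Image.
Variables (A B : zmodType) (f : {additive A -> B}).

Definition image_pred : pred B := fun u => `[< exists v, f v = u >].

Lemma image_closed : zmod_closed image_pred.
Proof.
split=> [|u v]; rewrite !unfold_in; first by apply/asboolP; exists 0; rewrite raddf0.
move=> /asboolP[u' <-] /asboolP[v' <-]; apply/asboolP.
by exists (u' - v'); rewrite raddfB.
Qed.

HB.instance Definition _ := GRing.isZmodClosed.Build B image_pred image_closed.

End Image.

Section Cokernel.
Variables (C : category) (F G : abfunctor C) (t : nattrans F G).
Local Open Scope quotient_scope.

Definition coker_ob x : zmodType :=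
  Quotient.quot (GRing.ZmodClosed.clone _ (image_pred (t x)) _).

Definition coker_proj x : G x -> coker_ob x := \pi.

Lemma coker_proj_is_zmod_morphism x : zmod_morphism (@coker_proj x).
Proof. by move=> u v; rewrite /coker_proj raddfB. Qed.

HB.instance Definition _ x := GRing.isZmodMorphism.Build (G x) (coker_ob x)
  (@coker_proj x) (@coker_proj_is_zmod_morphism x).

Lemma coker_projP x (u v : G x) :
  coker_proj u = coker_proj v <-> exists w, t x w = u - v.
Proof.
split=> [/eqP|] h.
  by move: h; rewrite /coker_proj -Quotient.idealrBE => /asboolP.
by apply/eqP; rewrite /coker_proj -Quotient.idealrBE; apply/asboolP.
Qed.

Definition coker_map x y (f : hom x y) (u : coker_ob x) : coker_ob y :=
  coker_proj (amap G f (repr u)).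

Lemma coker_mapE x y (f : hom x y) (u : G x) :
  coker_map f (coker_proj u) = coker_proj (amap G f u).
Proof.
apply/coker_projP; rewrite -raddfB.
have [w e] : exists w, t x w = repr (coker_proj u) - u.
  by apply/coker_projP; rewrite /coker_proj reprK.
by exists (amap F f w); rewrite -e ntnat.
Qed.

Lemma coker_projK x (u : coker_ob x) : exists v, u = coker_proj v.
Proof. by exists (repr u); rewrite /coker_proj reprK. Qed.

Lemma coker_map_is_zmod_morphism x y (f : hom x y) : zmod_morphism (coker_map f).
Proof.
move=> u v; have [u' ->] := coker_projK u; have [v' ->] := coker_projK v.
by rewrite -raddfB !coker_mapE !raddfB.
Qed.

HB.instance Definition _ x y (f : hom x y) :=
  GRing.isZmodMorphism.Build (coker_ob x) (coker_ob y)
    (@coker_map x y f) (@coker_map_is_zmod_morphism x y f).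

Program Definition coker : abfunctor C :=
  {| aob := coker_ob; amap := fun x y f => coker_map f |}.
Next Obligation.
by move=> x u /=; have [v ->] := coker_projK u; rewrite coker_mapE amapI.
Qed.
Next Obligation.
by move=> x y z g f u /=; have [v ->] := coker_projK u; rewrite !coker_mapE amapC.
Qed.

Program Definition coker_nt : nattrans G coker := {| ntcomp := fun x => @coker_proj x |}.
Next Obligation. by move=> x y f u /=; rewrite coker_mapE. Qed.

Lemma coker_nt_exact : is_exact t coker_nt.
Proof.
move=> x u; rewrite -[u in exists _, _ = u]subr0; split=> [h|h].
  by apply/coker_projP; rewrite raddf0.
by have /coker_projP := h; rewrite raddf0.
Qed.

End Cokernel.

Lemma injective_resolution_exists (C : category) :
  enough_injectives C -> forall F : abfunctor C, inhabited (injective_resolution F).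
Proof.
move=> enough F.
pose hull G := projT1 (cid (enough G)).
pose emb G : nattrans G (hull G) := projT1 (cid (projT2 (cid (enough G)))).
have [hull_inj emb_mono] : (forall G, is_injective (hull G)) /\ forall G, is_mono (emb G).
  by split=> G; have [] := projT2 (cid (projT2 (cid (enough G)))).
pose Q := fix Q n := if n is m.+1 then coker (emb (Q m)) else F.
pose d n : nattrans (hull (Q n)) (hull (Q n.+1)) :=
  nt_comp (emb (Q n.+1)) (coker_nt (emb (Q n))).
have dE n x u : d n x u = 0 <-> exists v, emb (Q n) x v = u.
  rewrite -(coker_nt_exact (emb (Q n)) u) /d /=; split=> [|->]; last exact: raddf0.
  by rewrite -[0](raddf0 (emb (coker (emb (Q n))) x)) => /emb_mono.
split; apply: (@InjectiveResolution _ _ (fun n => hull (Q n)) (emb F) d).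
- by move=> n; apply: hull_inj.
- exact: emb_mono.
- exact: (dE 0%N).
- move=> n x u; rewrite dE; split=> [[w <-]|[v <-]].
    by have [v ->] := coker_projK w; exists v.
  by exists (coker_proj (emb (Q n)) v).
Qed.

Program Definition lim_complex (C : category) (F : abfunctor C)
    (I : injective_resolution F) : complex :=
  {| cob := fun n => lim (I n); cdiff := fun n => lim_map (res_diff I n) |}.
Next Obligation.
move=> C F I n s /=; apply/val_inj/functional_extensionality_dep => x /=.
have [_ h] := @res_exactS _ _ I n x (res_diff I n x (lim_val s x)).
by apply: h; exists (lim_val s x).
Qed.

(** The right derived functors of [lim], computed from a chosen injective
    resolution of each functor. *)
Definition higher_lim (C : category) (enough : enough_injectives C) (n : nat)
    (F : abfunctor C) : zmodType :=
  cohomology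
    (lim_complex (inhabited_witness (injective_resolution_exists enough F))) n.

(** The object [n] stands for [{0 < ... < n}]. *)
Definition monotone n m (f : {ffun 'I_n.+1 -> 'I_m.+1}) : bool :=
  [forall i : 'I_n.+1, forall j : 'I_n.+1, (i <= j)%N ==> (f i <= f j)%N].

Definition simplex_hom n m := {f : {ffun 'I_n.+1 -> 'I_m.+1} | monotone f}.

Lemma monotoneP n m (f : {ffun 'I_n.+1 -> 'I_m.+1}) :
  reflect (forall i j : 'I_n.+1, (i <= j)%N -> (f i <= f j)%N) (monotone f).
Proof.
by apply: (iffP 'forall_'forall_implyP) => h i j /h.
Qed.

Lemma monotone_id n : monotone [ffun i : 'I_n.+1 => i].
Proof. by apply/monotoneP => i j; rewrite !ffunE. Qed.

Lemma monotone_comp n m p (g : simplex_hom m p) (f : simplex_hom n m) :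
  monotone [ffun i => val g (val f i)].
Proof.
apply/monotoneP => i j ij; rewrite !ffunE.
by apply: (monotoneP _ (valP g)); apply: (monotoneP _ (valP f)).
Qed.

Program Definition Simplex : category :=
  {| ob := nat; hom := simplex_hom;
     idm := fun n => exist _ _ (monotone_id n);
     comp := fun n m p g f => exist _ _ (monotone_comp g f) |}.
Next Obligation. by move=> n m f; apply/val_inj/ffunP => i; rewrite /= !ffunE. Qed.
Next Obligation. by move=> n m f; apply/val_inj/ffunP => i; rewrite /= !ffunE. Qed.
Next Obligation.
by move=> n m p q h g f; apply/val_inj/ffunP => i; rewrite /= !ffunE.
Qed.

Lemma monotone_lift n (j : 'I_n.+2) : monotone [ffun i : 'I_n.+1 => lift j i].
Proof. by apply/monotoneP => i k ik; rewrite !ffunE /= leq_bump2. Qed.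

Definition coface n (j : 'I_n.+2) : @hom Simplex n n.+1 :=
  exist _ [ffun i => lift j i] (monotone_lift j).

Lemma coface_comp n (i j' : 'I_n.+2) (i' j : 'I_n.+3) :
  i' = i :> nat -> j = j'.+1 :> nat -> (i <= j')%N ->
  comp (coface j) (coface i) = comp (coface i') (coface j').
Proof.
move=> ei ej ij; apply/val_inj/ffunP => k; rewrite /= !ffunE; apply: val_inj => /=.
by rewrite ei ej /bump; lia.
Qed.

Lemma alt_sum_cancel (V : zmodType) m (G : nat -> nat -> V) :
  (forall i j, (i <= j)%N -> (j < m)%N -> G j.+1 i = G i j) ->
  \sum_(j < m.+1) \sum_(i < m) G j i *~ (-1) ^+ (i + j) = 0.
Proof.
move=> GE.
under eq_bigr => j _ do rewrite (bigID (fun i : 'I_m => (i < j)%N)) /=.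
rewrite big_split /= big_ord_recl big_pred0 ?add0r => [|//].
rewrite [X in _ + X]big_ord_recr /= [X in _ + (_ + X)]big_pred0 ?addr0; last first.
  by move=> i; rewrite ltn_ord.
under [X in _ + X]eq_bigr => j _ do under eq_bigl => i do rewrite -leqNgt.
rewrite [X in _ + X](exchange_big_dep xpredT) //= -big_split big1 //= => j _.
rewrite -big_split big1 //= => i; rewrite /bump add1n ltnS => ij.
by rewrite GE // addnS exprS mulN1r mulrNz addnC addNr.
Qed.

Section AlternateSum.
Variable A : abfunctor Simplex.

Definition alt_diff (n : nat) (u : A n) : A n.+1 :=
  \sum_(i < n.+2) amap A (coface i) u *~ (-1) ^+ i.

Lemma alt_diff_is_zmod_morphism n : zmod_morphism (@alt_diff n).
Proof.
move=> u v; rewrite /alt_diff -sumrB; apply: eq_bigr => i _.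
by rewrite raddfB mulrzBl.
Qed.

HB.instance Definition _ n := GRing.isZmodMorphism.Build (A n) (A n.+1)
  (@alt_diff n) (@alt_diff_is_zmod_morphism n).

Lemma alt_diffK n (u : A n) : alt_diff (alt_diff u) = 0.
Proof.
pose G j i : A n.+2 :=
  amap A (coface (inord j : 'I_n.+3)) (amap A (coface (inord i : 'I_n.+2)) u).
rewrite -[RHS](@alt_sum_cancel _ n.+2 G) => [|i j ij jn]; last first.
  by rewrite /G -!amapC (@coface_comp _ _ (inord j) (inord i)) ?inordK //; lia.
apply: eq_bigr => j _; rewrite /alt_diff raddf_sum mulrz_suml.
apply: eq_bigr => i _; rewrite raddfMz -mulrzA -exprD /G.
by rewrite !inord_val.
Qed.

Definition alt_complex : complex :=
  {| cob := fun n => A n; cdiff := fun n => @alt_diff n; cdiffK := alt_diffK |}.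

Definition cosimplicial_pi (n : nat) : zmodType := cohomology alt_complex n.

End AlternateSum.

Definition strongly_connected (C : category) : Prop :=
  forall x y : C, inhabited (hom x y).

Definition has_pairwise_coproducts (C : category) : Prop :=
  forall x y : C, exists (s : C) (a : hom x s) (b : hom y s),
    forall (z : C) (f : hom x z) (g : hom y z),
      exists! h : hom s z, comp h a = f /\ comp h b = g.

Record copower (C : category) (c : C) (n : nat) := Copower {
  cop_ob :> C;
  cop_in : 'I_n -> hom c cop_ob;
  cop_univ : forall (z : C) (g : 'I_n -> hom c z),
    exists! h : hom cop_ob z, forall j, comp h (cop_in j) = g j
}.

Definition cotuple (C : category) (c : C) (n : nat) (S : copower c n) (z : C)
    (g : 'I_n -> hom c z) : hom S z := projT1 (cid (cop_univ S g)).

Lemma cotupleE (C : category) (c : C) n (S : copower c n) (z : C)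
    (g : 'I_n -> hom c z) j :
  comp (cotuple S g) (cop_in S j) = g j.
Proof. by rewrite /cotuple; case: cid => h [/= ->]. Qed.

Lemma copower_ext (C : category) (c : C) n (S : copower c n) (z : C) (f g : hom S z) :
  (forall j, comp f (cop_in S j) = comp g (cop_in S j)) -> f = g.
Proof.
move=> fg; have [h [_ hu]] := cop_univ S (fun j => comp g (cop_in S j)).
by rewrite -(hu f) // -(hu g).
Qed.

Lemma copower_exists (C : category) :
  has_pairwise_coproducts C -> forall (c : C) n, inhabited (copower c n.+1).
Proof.
move=> coprod c; elim=> [|n [S]].
  split; apply: (@Copower _ c 1 c (fun=> idm c)) => z g; exists (g ord0).
  split=> [j|h /(_ ord0) <-]; last by rewrite compmI.
  by rewrite compmI (ord1 j).
have [s [a [b sP]]] := coprod S c.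
pose inj (k : 'I_n.+2) : hom c s :=
  if unlift ord_max k is Some j then comp a (cop_in S j) else b.
have inj_lift j : inj (lift ord_max j) = comp a (cop_in S j) by rewrite /inj liftK.
have inj_max : inj ord_max = b by rewrite /inj unlift_none.
split; apply: (@Copower _ c n.+2 s inj) => z g.
have [h [[ha hb] hu]] := sP z (cotuple S (fun j => g (lift ord_max j))) (g ord_max).
exists h; split=> [k|h' hk].
  case: (unliftP ord_max k) => [j|] ->; last by rewrite inj_max.
  by rewrite inj_lift compA ha cotupleE.
apply: hu; split; last by rewrite -hk inj_max.
by apply: copower_ext => j; rewrite cotupleE -hk inj_lift compA.
Qed.

Section StandardComplex.
Variables (C : category) (coprod : has_pairwise_coproducts C) (c : C).

Definition standard_copower (n : nat) : copower c n.+1 :=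
  inhabited_witness (copower_exists coprod c n).

Program Definition standard_complex : functor Simplex C :=
  {| fob := fun n => standard_copower n;
     fmap := fun n m f =>
       cotuple (standard_copower n) (fun j => cop_in (standard_copower m) (val f j)) |}.
Next Obligation.
by move=> n; apply: copower_ext => j; rewrite cotupleE compIm /= ffunE.
Qed.
Next Obligation.
move=> n m p g f; apply: copower_ext => j.
by rewrite -compA !cotupleE /= ffunE.
Qed.

End StandardComplex.

(* Main.v *)
From HB Require Import structures.
From mathcomp Require Import all_boot all_algebra.
From mathcomp Require Import boolp.
Require Import Defs.

(** Why the theorem holds.  Let [I] be an injective resolution of [F] and [B] the
    standard complex of [c].  The groups [I p (B q)] form a double complex in the
    first quadrant, with the complex [lim I] along one edge and the complex
    [F B] along the other.  Evaluated at a fixed object [B q], the resolution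
    is an exact sequence beginning at [F (B q)]; this is objectwise exactness.  If
    moreover each sequence [lim (I p) -> I p (B 0) -> I p (B 1) -> ...] is exact,
    the usual diagram chase shows that both edges have the same cohomology.

    That sequence is exact in degree zero for every functor [G]
    ([lim_standard_exact]): two maps [f, g : c -> x] factor through a single map
    [c + c -> x], so an element of [G c] that is equalized by the two inclusions
    of [c] in [c + c] has the same image under [f] and [g].  As there is at least
    one map from [c] to every object, such an element is the same thing as a
    compatible family, that is, an element of [lim G].

    In higher degrees it is exact for injective [I] ([injective_standard_exact]).
    The functor [coind I : x |-> prod_y prod_(f : x -> y) I y] contains [I], so
    injectivity makes [I] a direct summand of it.  The standard complex
    of [coind I] is the product over [y] of the groups of functions on the
    simplicial set [Hom (c, y) ^ (n + 1)] with values in [I y].  This simplicial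
    set is contractible because [Hom (c, y)] is not empty: prepending a chosen map
    [c -> y] is an extra degeneracy.

    The diagram chase ([double_complex_cohomology]) passes from one edge to the
    other along an antidiagonal.  Its steps do not define functions on
    cochains but additive relations between them, so isomorphisms of cohomology
    groups are represented by such relations ([correspondence]), which are easy to
    compose and to invert; only the composite is turned into a map of quotients. *)

Set Implicit Arguments.
Unset Strict Implicit.
Unset Printing Implicit Defensive.

Import GRing.Theory.
Local Open Scope ring_scope.
#[local] Obligation Tactic := idtac.

(** * Additive relations between subquotients *)

(** Kept unquotiented: relations between representatives compose without choosing
    representatives. *)
Record subquotient := Subquotient {
  sq_group :> zmodType;
  sq_cycle : sq_group -> Prop;
  sq_boundary : sq_group -> Prop
}.

(** The graph of an isomorphism between subquotients, pulled back to
    representatives: a cycle may be related to many cycles, and [corr_boundary]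
    together with [corr_sub] makes them homologous. *)
Record correspondence (X Y : subquotient) (R : X -> Y -> Prop) : Prop := Correspondence {
  corr_cycle : forall u v, R u v -> sq_cycle u /\ sq_cycle v;
  corr_sub : forall u v u' v', R u v -> R u' v' -> R (u - u') (v - v');
  corr_total : forall u, sq_cycle u -> exists v, R u v;
  corr_onto : forall v, sq_cycle v -> exists u, R u v;
  corr_boundary : forall u v, R u v -> sq_boundary u <-> sq_boundary v
}.

Definition corresponding (X Y : subquotient) : Prop :=
  exists R : X -> Y -> Prop, correspondence R.

Lemma corresponding_sym X Y : corresponding X Y -> corresponding Y X.
Proof.
case=> R [Rc RB Rt Ro Rb]; exists (fun v u => R u v); split=> //.
- by move=> v u /Rc[].
- by move=> v u v' u' r r'; apply: RB.
- by move=> v u /Rb ->.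
Qed.

Lemma corresponding_trans Y X Z :
  corresponding X Y -> corresponding Y Z -> corresponding X Z.
Proof.
case=> R [Rc RB Rt Ro Rb] [S [Sc SB St So Sb]].
exists (fun u w => exists2 v, R u v & S v w); split.
- by move=> u w [v /Rc[cu _] /Sc[_ cw]].
- move=> u w u' w' [v uv vw] [v' uv' vw'].
  by exists (v - v'); [apply: RB | apply: SB].
- move=> u /Rt[v uv]; have [_ /St[w vw]] := Rc _ _ uv.
  by exists w, v.
- move=> w /So[v vw]; have [/Ro[u uv] _] := Sc _ _ vw.
  by exists u, v.
- by move=> u w [v /Rb -> /Sb].
Qed.

Definition cohomology_sq (A : complex) (n : nat) : subquotient :=
  {| sq_group := A n; sq_cycle := fun u => cdiff A n u = 0;
     sq_boundary := @is_coboundary A n |}.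

Definition cohomology_class (A : complex) n (u : cocycle A n) : cohomology A n :=
  (\pi u)%qT.

Lemma cohomology_class_is_zmod_morphism (A : complex) n :
  zmod_morphism (@cohomology_class A n).
Proof. by move=> u v; rewrite /cohomology_class raddfB. Qed.

HB.instance Definition _ (A : complex) n :=
  GRing.isZmodMorphism.Build (cocycle A n) (cohomology A n) (@cohomology_class A n)
    (@cohomology_class_is_zmod_morphism A n).

Lemma cohomology_class_onto (A : complex) n (z : cohomology A n) :
  exists u, cohomology_class u = z.
Proof. by exists (repr z); rewrite /cohomology_class reprK. Qed.

Lemma cohomology_class_eq (A : complex) n (u v : cocycle A n) :
  cohomology_class u = cohomology_class v <-> is_coboundary (val u - val v).
Proof.
rewrite -[_ - _]raddfB; split=> [/eqP|h].
  by rewrite -Quotient.idealrBE => /asboolP.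
by apply/eqP; rewrite -Quotient.idealrBE; apply/asboolP.
Qed.

Lemma cocycleP (A : complex) n (u : cocycle A n) : cdiff A n (val u) = 0.
Proof. by apply/eqP; exact: (valP u). Qed.

Lemma cocycle_of (A : complex) n (u : A n) :
  cdiff A n u = 0 -> exists z : cocycle A n, val z = u.
Proof. by move=> /eqP u0; exists (Cocycle u0). Qed.

(** Sending the class of [u] to the class of any [v] related to it is well
    defined, additive and injective for the same reason: a difference of related
    pairs is a related pair, and boundaries are related only to boundaries. *)
Lemma corresponding_cohomology (A B : complex) n m :
  corresponding (cohomology_sq A n) (cohomology_sq B m) ->
  exists f : {additive cohomology A n -> cohomology B m}, bijective f.
Proof.
case=> R [Rc RB Rt Ro Rb].
have tot z : exists w, exists u v,
    [/\ cohomology_class u = z, cohomology_class v = w & R (val u) (val v)].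
  have [u <-] := cohomology_class_onto z; have [v r] := Rt _ (cocycleP u).
  have [_ /cocycle_of[v' ev]] := Rc _ _ r.
  by exists (cohomology_class v'), u, v'; rewrite ev.
pose f z := projT1 (cid (tot z)).
have fP z : exists u v,
    [/\ cohomology_class u = z, cohomology_class v = f z & R (val u) (val v)].
  exact: projT2 (cid (tot z)).
have fE u v : R (val u) (val v) -> f (cohomology_class u) = cohomology_class v.
  have [u' [v' [eu <- r']]] := fP (cohomology_class u) => r.
  by apply/cohomology_class_eq/(Rb _ _ (RB _ _ _ _ r' r))/cohomology_class_eq.
have f_additive : zmod_morphism f.
  move=> z z'; have [u [v [<- <- r]]] := fP z; have [u' [v' [<- <- r']]] := fP z'.
  by rewrite -!raddfB; apply: fE; rewrite !raddfB; apply: RB.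
have f_inj : injective f.
  move=> z z'; have [u [v [<- <- r]]] := fP z; have [u' [v' [<- <- r']]] := fP z'.
  by move=> /cohomology_class_eq/(Rb _ _ (RB _ _ _ _ r r'))/cohomology_class_eq.
have f_onto w : exists z, f z = w.
  have [v <-] := cohomology_class_onto w; have [u r] := Ro _ (cocycleP v).
  have [/cocycle_of[u' eu] _] := Rc _ _ r.
  by exists (cohomology_class u'); apply: fE; rewrite eu.
pose fA := GRing.isZmodMorphism.Build _ _ f f_additive.
exists (HB.pack_for {additive cohomology A n -> cohomology B m} f fA).
exists (fun w => projT1 (cid (f_onto w))) => [z|w] /=; last by case: cid.
by apply: f_inj; case: cid.
Qed.

(** * Double complexes with exact rows and columns *)

Section DoubleComplex.
Variables (A B : complex) (K : nat -> nat -> zmodType).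
Variables (dh : forall p q, {additive K p q -> K p.+1 q})
          (dv : forall p q, {additive K p q -> K p q.+1}).
Variables (eps : forall p, {additive A p -> K p 0})
          (eta : forall q, {additive B q -> K 0 q}).

(** The images of the maps into [K p q] of its row and of its column, the
    augmentations being the maps into the edges [p = 0] and [q = 0]. *)
Definition from_left p q : K p q -> Prop :=
  match p with
  | 0 => fun u => exists b, eta q b = u
  | p'.+1 => fun u => exists w, dh p' q w = u
  end.

Definition from_below p q : K p q -> Prop :=
  match q with
  | 0 => fun u => exists a, eps p a = u
  | q'.+1 => fun u => exists w, dv p q' w = u
  end.

Hypothesis dhv : forall p q u, dh p q.+1 (dv p q u) = dv p.+1 q (dh p q u).
Hypothesis epsd : forall p a, eps p.+1 (cdiff A p a) = dh p 0 (eps p a).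
Hypothesis etad : forall q b, eta q.+1 (cdiff B q b) = dv 0 q (eta q b).
Hypothesis eps_inj : forall p, injective (eps p).
Hypothesis eta_inj : forall q, injective (eta q).
Hypothesis row_exact : forall p q u, dh p q u = 0 <-> from_left u.
Hypothesis col_exact : forall p q u, dv p q u = 0 <-> from_below u.

Lemma eps_eq0 p a : eps p a = 0 -> a = 0.
Proof. by rewrite -[0](raddf0 (eps p)) => /eps_inj. Qed.

Lemma eta_eq0 q b : eta q b = 0 -> b = 0.
Proof. by rewrite -[0](raddf0 (eta q)) => /eta_inj. Qed.

(** The subquotient through which degree [p + q + 1] passes at position [(p, q)].  A
    cycle [y] is a corner of a staircase: [dh y] and [dv y] are both annihilated by
    [dh] and [dv], hence come, by exactness, from a neighbouring corner or from an
    edge. *)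
Definition diagonal_sq p q : subquotient :=
  {| sq_group := K p q; sq_cycle := fun y => dh p q.+1 (dv p q y) = 0;
     sq_boundary := fun y => exists2 v, from_below v & from_left (y - v) |}.

(** In degree zero both sides are the subgroup of [K 0 0] annihilated by [dh] and
    [dv], so an element is related to another when their augmentations agree. *)
Lemma degree0_corresponding :
  corresponding (cohomology_sq A 0) (cohomology_sq B 0).
Proof.
have ch u v : eps 0 u = eta 0 v -> cdiff A 0 u = 0.
  move=> r; apply: eps_eq0; rewrite epsd r; apply/row_exact; by exists v.
have cv u v : eps 0 u = eta 0 v -> cdiff B 0 v = 0.
  move=> r; apply: eta_eq0; rewrite etad -r; apply/col_exact; by exists u.
exists (fun a b => eps 0 a = eta 0 b); split=> /=.
- by move=> u v r; split; [apply: ch r | apply: cv r].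
- by move=> u v u' v' r r'; rewrite !raddfB r r'.
- move=> u /= u0; have /row_exact[v r] : dh 0 0 (eps 0 u) = 0.
    by rewrite -epsd u0 raddf0.
  by exists v.
- move=> v /= v0; have /col_exact[u r] : dv 0 0 (eta 0 v) = 0.
    by rewrite -etad v0 raddf0.
  by exists u.
- move=> u v r; split=> e; move: r; rewrite e raddf0.
    by move=> /esym/eta_eq0.
  exact: eps_eq0.
Qed.

(** Consecutive corners of a staircase have a common image in [K p.+1 q.+1]. *)
Lemma diagonal_shift p q : corresponding (diagonal_sq p.+1 q) (diagonal_sq p q.+1).
Proof.
exists (fun y y' => dv p.+1 q y = dh p q.+1 y'); split=> /=.
- move=> y y' r; split; first by rewrite r; apply/row_exact; exists y'.
  by rewrite dhv -r; apply/col_exact; exists y.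
- by move=> u v u' v' r r'; rewrite !raddfB r r'.
- by move=> y /row_exact[y' r]; exists y'.
- by move=> y'; rewrite dhv => /col_exact[y r]; exists y.
- move=> y y' r; split.
    move=> [v /col_exact v0 [z ez]].
    (* y = v + dh z, and v does not contribute to dv y = dh y', so y' and dv z
       differ by an element of the kernel of dh. *)
    exists (dv p q z); first by exists z.
    by apply/row_exact; rewrite raddfB -r dhv ez raddfB v0 subr0 subrr.
  move=> [_ [z <-] /row_exact]; rewrite raddfB dhv -r -raddfB => /col_exact h.
  exists (y - dh p q z) => //; exists z.
  by rewrite opprB addrC subrK.
Qed.

(** A staircase that reaches the edge [p = 0] ends with a cocycle of [B], one
    that reaches the edge [q = 0] with a cocycle of [A] ([diagonal_bottom]). *)
Lemma diagonal_left q : corresponding (diagonal_sq 0 q) (cohomology_sq B q.+1).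
Proof.
exists (fun y b => dv 0 q y = eta q.+1 b); split=> /=.
- move=> y b r; split; first by rewrite r; apply/row_exact; exists b.
  by apply: eta_eq0; rewrite etad -r; apply/col_exact; exists y.
- by move=> u v u' v' r r'; rewrite !raddfB r r'.
- by move=> y /row_exact[b r]; exists b.
- move=> b b0; have /col_exact[y r] : dv 0 q.+1 (eta q.+1 b) = 0.
    by rewrite -etad b0 raddf0.
  by exists y.
- move=> y b r; split.
    move=> [v /col_exact v0 [b' eb]]; exists b'; apply: eta_inj.
    by rewrite -r etad eb raddfB v0 subr0.
  move=> [b' eb]; exists (y - eta q b').
    by apply/col_exact; rewrite raddfB -etad eb r subrr.
  by exists b'; rewrite opprB addrC subrK.
Qed.

Lemma diagonal_bottom p : corresponding (diagonal_sq p 0) (cohomology_sq A p.+1).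
Proof.
exists (fun y a => dh p 0 y = eps p.+1 a); split=> /=.
- move=> y a r; split; first by rewrite dhv r; apply/col_exact; exists a.
  by apply: eps_eq0; rewrite epsd -r; apply/row_exact; exists y.
- by move=> u v u' v' r r'; rewrite !raddfB r r'.
- by move=> y; rewrite dhv => /col_exact[a r]; exists a.
- move=> a a0; have /row_exact[y r] : dh p.+1 0 (eps p.+1 a) = 0.
    by rewrite -epsd a0 raddf0.
  by exists y.
- move=> y a r; split.
    move=> [_ [a' <-] /row_exact]; rewrite raddfB -epsd r => /eqP.
    by rewrite subr_eq0 => /eqP/eps_inj ->; exists a'.
  move=> [a' ea]; exists (eps p a'); first by exists a'.
  by apply/row_exact; rewrite raddfB -epsd ea r subrr.
Qed.

Lemma double_complex_cohomology n :
  corresponding (cohomology_sq A n) (cohomology_sq B n).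
Proof.
case: n => [|n]; first exact: degree0_corresponding.
apply: corresponding_trans (corresponding_sym (diagonal_bottom n)) _.
suff gen p q : corresponding (diagonal_sq p q) (cohomology_sq B (p + q).+1).
  by rewrite -[n in cohomology_sq B n.+1]addn0.
elim: p q => [|p IHp] q; first exact: diagonal_left.
by rewrite addSnnS; apply: corresponding_trans (diagonal_shift p q) (IHp q.+1).
Qed.

End DoubleComplex.
(** * Cosimplicial groups with an extra codegeneracy *)

Section ExtraCodegeneracy.
Variables (A : abfunctor Simplex) (s : forall n, {additive A n.+1 -> A n}).
Hypothesis s_coface0 : forall n (u : A n), s n (amap A (coface ord0) u) = u.
Hypothesis s_cofaceS : forall n (i : 'I_n.+2) (u : A n.+1),
  s n.+1 (amap A (coface (lift ord0 i)) u) = amap A (coface i) (s n u).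

(** The term [i = 0] of [s (alt_diff u)] is [u], and moving [s] past the other
    cofaces lowers their index by one, which changes their signs. *)
Lemma extra_codegeneracy_homotopy n (u : A n.+1) :
  s n.+1 (alt_diff u) = u - alt_diff (s n u).
Proof.
rewrite /alt_diff big_ord_recl expr0 mulr1z raddfD /= s_coface0 raddf_sum /= -sumrN.
congr (_ + _); apply: eq_bigr => i _.
by rewrite raddfMz s_cofaceS /bump add1n exprS mulN1r mulrNz.
Qed.

Lemma extra_codegeneracy_exact n (u : A n.+1) :
  alt_diff u = 0 -> exists v : A n, alt_diff v = u.
Proof.
move=> u0; exists (s n u); apply/esym/eqP.
by rewrite -subr_eq0 -extra_codegeneracy_homotopy u0 raddf0.
Qed.

End ExtraCodegeneracy.

Lemma nattrans_alt_diff (C : category) (F G : abfunctor C) (B : functor Simplex C)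
    (t : nattrans F G) n (u : F (B n)) :
  t _ (@alt_diff (compose F B) n u) = @alt_diff (compose G B) n (t _ u).
Proof.
by rewrite raddf_sum; apply: eq_bigr => i _; rewrite raddfMz /= ntnat.
Qed.

(** * Coinduced functors *)

Section Coinduced.
Variables (C : category) (F : abfunctor C).

(** The right Kan extension, along the inclusion of the discrete category on the
    objects of [C], of the restriction of [F] to it. *)
Definition coind_ob (x : C) : Type := forall y, hom x y -> F y.

HB.instance Definition _ x := Choice.copy (coind_ob x) (forall y, hom x y -> F y).

Section Group.
Variable x : C.
Implicit Types s t u : coind_ob x.

Definition coind0 : coind_ob x := fun y f => 0.
Definition coindN s : coind_ob x := fun y f => - s y f.
Definition coindD s t : coind_ob x := fun y f => s y f + t y f.

Lemma coind_ext s t : (forall y f, s y f = t y f) -> s = t.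
Proof.
move=> st; apply/functional_extensionality_dep => y.
exact/functional_extensionality_dep/st.
Qed.

Lemma coindDA : associative coindD.
Proof. by move=> s t u; apply: coind_ext => y f; apply: addrA. Qed.
Lemma coindDC : commutative coindD.
Proof. by move=> s t; apply: coind_ext => y f; apply: addrC. Qed.
Lemma coind0D : left_id coind0 coindD.
Proof. by move=> s; apply: coind_ext => y f; apply: add0r. Qed.
Lemma coindND : left_inverse coind0 coindN coindD.
Proof. by move=> s; apply: coind_ext => y f; apply: addNr. Qed.

HB.instance Definition _ :=
  GRing.isZmodule.Build (coind_ob x) coindDA coindDC coind0D coindND.

End Group.

Definition coind_map x x' (d : hom x x') (s : coind_ob x) : coind_ob x' :=
  fun y f => s y (comp f d).

Lemma coind_map_is_zmod_morphism x x' (d : hom x x') : zmod_morphism (coind_map d).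
Proof. by []. Qed.

HB.instance Definition _ x x' (d : hom x x') :=
  GRing.isZmodMorphism.Build (coind_ob x) (coind_ob x') (@coind_map x x' d)
    (@coind_map_is_zmod_morphism x x' d).

Program Definition coind : abfunctor C :=
  {| aob := coind_ob; amap := fun x y f => coind_map f |}.
Next Obligation. by move=> x u; apply: coind_ext => y f; rewrite /= /coind_map compmI. Qed.
Next Obligation.
by move=> x y z g f u; apply: coind_ext => t h; rewrite /= /coind_map compA.
Qed.

(** The unit of the adjunction between restriction and coinduction. *)
Definition to_coind_ob x (u : F x) : coind_ob x := fun y f => amap F f u.

Lemma to_coind_ob_is_zmod_morphism x : zmod_morphism (@to_coind_ob x).
Proof. by move=> u v; apply: coind_ext => y f; apply: raddfB. Qed.

HB.instance Definition _ x := GRing.isZmodMorphism.Build (F x) (coind_ob x)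
  (@to_coind_ob x) (@to_coind_ob_is_zmod_morphism x).

Program Definition to_coind : nattrans F coind :=
  {| ntcomp := fun x => @to_coind_ob x |}.
Next Obligation.
by move=> x y f u; apply: coind_ext => z g; rewrite /= /coind_map /to_coind_ob amapC.
Qed.

Lemma to_coind_mono : is_mono to_coind.
Proof.
move=> x u v uv; rewrite -[u]amapI -[v]amapI.
exact: (congr1 (fun s : coind_ob x => s x (idm x)) uv).
Qed.

End Coinduced.

(** * Exactness of the standard complex *)

Section Standard.
Variables (C : category) (connected : strongly_connected C)
          (coprod : has_pairwise_coproducts C) (c : C).
Local Notation B := (standard_complex coprod c).

Definition standard_in n (j : 'I_n.+1) : hom c (B n) :=
  cop_in (standard_copower coprod c n) j.

Definition standard_tuple n x (g : 'I_n.+1 -> hom c x) : hom (B n) x :=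
  cotuple (standard_copower coprod c n) g.

Lemma standard_tupleE n x (g : 'I_n.+1 -> hom c x) j :
  comp (standard_tuple g) (standard_in j) = g j.
Proof. exact: cotupleE. Qed.

Lemma standard_ext n x (f g : hom (B n) x) :
  (forall j, comp f (standard_in j) = comp g (standard_in j)) -> f = g.
Proof. exact: copower_ext. Qed.

Lemma standard_coface n (i : 'I_n.+2) j :
  comp (fmap B (coface i)) (standard_in j) = standard_in (lift i j).
Proof. by rewrite /= cotupleE /= ffunE. Qed.

(** In terms of tuples of maps from [c], this prepends [h] to [f]. *)
Definition cons_hom n x (h : hom c x) (f : hom (B n) x) : hom (B n.+1) x :=
  standard_tuple (fun j => if unlift ord0 j is Some i then comp f (standard_in i) else h).

Lemma cons_hom0 n x (h : hom c x) (f : hom (B n) x) :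
  comp (cons_hom h f) (standard_in ord0) = h.
Proof. by rewrite standard_tupleE unlift_none. Qed.

Lemma cons_homS n x (h : hom c x) (f : hom (B n) x) j :
  comp (cons_hom h f) (standard_in (lift ord0 j)) = comp f (standard_in j).
Proof. by rewrite standard_tupleE liftK. Qed.

Lemma cons_hom_coface0 n x (h : hom c x) (f : hom (B n) x) :
  comp (cons_hom h f) (fmap B (coface ord0)) = f.
Proof. by apply: standard_ext => j; rewrite -compA standard_coface cons_homS. Qed.

Lemma cons_hom_cofaceS n x (h : hom c x) (f : hom (B n.+1) x) i :
  comp (cons_hom h f) (fmap B (coface (lift ord0 i))) =
  cons_hom h (comp f (fmap B (coface i))).
Proof.
apply: standard_ext => j; rewrite -compA standard_coface.
have [k|] := unliftP ord0 j => ->.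
  have -> : lift (lift ord0 i) (lift ord0 k) = lift ord0 (lift i k) :> 'I_n.+3.
    by apply: val_inj; rewrite /= /bump !add1n ltnS addnS.
  by rewrite !cons_homS -compA standard_coface.
have -> : lift (lift ord0 i) ord0 = ord0 :> 'I_n.+3 by apply: val_inj.
by rewrite !cons_hom0.
Qed.

Section CoindContraction.
Variable F : abfunctor C.
Let point x : hom c x := inhabited_witness (connected c x).

Definition coind_contract n (s : coind F (B n.+1)) : coind F (B n) :=
  fun x f => s x (cons_hom (point x) f).

Lemma coind_contract_is_zmod_morphism n : zmod_morphism (@coind_contract n).
Proof. by []. Qed.

HB.instance Definition _ n :=
  GRing.isZmodMorphism.Build (coind F (B n.+1)) (coind F (B n)) (@coind_contract n)
    (@coind_contract_is_zmod_morphism n).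

(** Precomposing with the operation of prepending a fixed map [c -> x] is an extra
    codegeneracy, because of [cons_hom_coface0] and [cons_hom_cofaceS]. *)
Lemma coind_standard_exact n (u : coind F (B n.+1)) :
  @alt_diff (compose (coind F) B) n.+1 u = 0 ->
  exists v, @alt_diff (compose (coind F) B) n v = u.
Proof.
apply: (@extra_codegeneracy_exact (compose (coind F) B) (fun n => @coind_contract n)).
- move=> m s; apply: coind_ext => x f.
  by rewrite /= /coind_contract /coind_map cons_hom_coface0.
- move=> m i s; apply: coind_ext => x f.
  by rewrite /= /coind_contract /coind_map cons_hom_cofaceS.
Qed.

End CoindContraction.

(** Exactness passes from [coind I] to its direct summand [I]. *)
Lemma injective_standard_exact (I : abfunctor C) n (u : I (B n.+1)) :
  is_injective I -> @alt_diff (compose I B) n.+1 u = 0 ->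
  exists v, @alt_diff (compose I B) n v = u.
Proof.
pose id_I : nattrans I I := @NatTrans C I I (fun x => idfun) (fun x y f v => erefl).
move=> inj u0; have [r rK] := inj _ _ (to_coind I) id_I (@to_coind_mono _ I).
have [v ev] : exists v, @alt_diff (compose (coind I) B) n v = to_coind I _ u.
  by apply: coind_standard_exact; rewrite -nattrans_alt_diff u0 raddf0.
by exists (r _ v); rewrite -nattrans_alt_diff ev rK.
Qed.

(** A compatible family is determined by its value at any object that maps to
    every other object. *)
Lemma lim_val_standard_inj (F : abfunctor C) :
  injective (fun s : lim F => lim_val s (B 0)).
Proof.
move=> s t st; apply/val_inj/functional_extensionality_dep => x /=.
by have [f] := connected (B 0) x; rewrite -!(limP _ f) /= st.
Qed.

(** The universal property of [B 1] as the coproduct of two copies of [B 0]. *)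
Lemma standard_coface_pair x (f g : hom (B 0) x) :
  exists h : hom (B 1) x,
    comp h (fmap B (coface ord0)) = f /\ comp h (fmap B (coface ord_max)) = g.
Proof.
exists (cons_hom (comp g (standard_in ord0)) f); rewrite cons_hom_coface0.
split=> //; apply: standard_ext => j; rewrite -compA standard_coface.
have -> : lift ord_max j = ord0 :> 'I_2 by apply: val_inj; rewrite [j]ord1.
by rewrite cons_hom0 [j]ord1.
Qed.

(** The family attached to [u] has the value [F f u] at [x], for any [f : B 0 -> x];
    that [u] is a cocycle says exactly that the choice of [f] does not matter. *)
Lemma lim_standard_exact (F : abfunctor C) (u : F (B 0)) :
  @alt_diff (compose F B) 0 u = 0 <-> exists s : lim F, lim_val s (B 0) = u.
Proof.
have diffE : @alt_diff (compose F B) 0 u =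
    amap F (fmap B (coface ord0)) u - amap F (fmap B (coface ord_max)) u.
  rewrite /alt_diff big_ord_recl big_ord1 /= expr0 mulr1z expr1 mulrN1z.
  by congr (_ - amap F (fmap B (coface _)) u); apply: val_inj.
rewrite diffE; split=> [/eqP|[s <-]]; last by rewrite !limP subrr.
rewrite subr_eq0 => /eqP u01.
have indep x (f g : hom (B 0) x) : amap F f u = amap F g u.
  by have [h [<- <-]] := standard_coface_pair f g; rewrite !amapC u01.
pose point x : hom (B 0) x := inhabited_witness (connected (B 0) x).
have pointP : @compatible C F (fun x => amap F (point x) u).
  by apply/asboolP => x y f; rewrite -amapC; apply: indep.
by exists (Lim pointP); rewrite /= -[RHS]amapI; apply: indep.
Qed.

End Standard.

(** * Comparison of the two complexes *)

Definition lim_eval (C : category) (F : abfunctor C) (x : C) (s : lim F) : F x :=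
  lim_val s x.

Lemma lim_eval_is_zmod_morphism (C : category) (F : abfunctor C) x :
  zmod_morphism (@lim_eval C F x).
Proof. by []. Qed.

HB.instance Definition _ (C : category) (F : abfunctor C) x :=
  GRing.isZmodMorphism.Build (lim F) (F x) (@lim_eval C F x)
    (@lim_eval_is_zmod_morphism C F x).

(** Stated for an arbitrary resolution because the one that computes [higher_lim] is
    obtained by choice. *)
Lemma lim_complex_standard (C : category) (connected : strongly_connected C)
    (coprod : has_pairwise_coproducts C) (F : abfunctor C) (c : C) (n : nat)
    (I : injective_resolution F) :
  corresponding (cohomology_sq (lim_complex I) n)
    (cohomology_sq (alt_complex (compose F (standard_complex coprod c))) n).
Proof.
pose B := standard_complex coprod c.
apply: (@double_complex_cohomology (lim_complex I) (alt_complex (compose F B))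
  (fun p q => I p (B q)) (fun p q => res_diff I p (B q))
  (fun p q => cdiff (alt_complex (compose (I p) B)) q)
  (fun p => @lim_eval C (I p) (B 0)) (fun q => res_aug I (B q))).
- by move=> p q u; apply: nattrans_alt_diff.
- by [].
- by move=> q b; apply: nattrans_alt_diff.
- move=> p; exact: lim_val_standard_inj.
- move=> q; exact: res_mono.
- by case=> [|p] q u; [apply: res_exact0 | apply: res_exactS].
- move=> p [|q] u; first exact: lim_standard_exact.
  split; first exact: (injective_standard_exact connected (@res_inj _ _ I p)).
  by move=> [v <-]; apply: (@alt_diffK (compose (I p) B) q v).
Qed.

Theorem theorem2p12 (C : category) (enough : enough_injectives C)
    (connected : strongly_connected C) (coprod : has_pairwise_coproducts C)
    (F : abfunctor C) (c : C) (n : nat) :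
  exists f : {additive higher_lim enough n F ->
                cosimplicial_pi (compose F (standard_complex coprod c)) n},
    bijective f.
Proof. exact/corresponding_cohomology/lim_complex_standard. Qed.
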